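(* Let $\mathbb K$ be a field, let $A$ be a commutative associative $\mathbb K$-algebra with identity which is an integral domain, let $R$ be the quotient field of $A$, and let $W(A)=R\,\mathrm{Der}\,A$. Let $L$ be a nilpotent $\mathbb K$-subalgebra of $W(A)$ and let $F=F(L)$ be its field of constants. Then: 1. If $\mathrm{rk}_R L=1$, then $L$ is abelian and $\dim_F FL=1$. 2. If $\mathrm{rk}_R L=2$, then there exist an integer $k\ge 0$, elements $D_1,D_2\in FL$ and $a\in R$ such that $$FL=F\Big\langle D_1,\ aD_1,\ \ldots,\ \frac{a^k}{k!}D_1,\ D_2\Big\rangle ,$$ where $[D_1,D_2]=0$, $D_1(a)=0$, $D_2(a)=1$. If $k=0$, this is to be read as $FL=F\langle D_1,D_2\rangle$ with $[D_1,D_2]=0$, and no element $a$ is involved.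
   Context: $\mathrm{Der}\,A$ denotes the Lie algebra of all $\mathbb K$-derivations of $A$; it is an $A$-module via $(aD)(x)=a\cdot D(x)$. Every derivation of $A$ extends uniquely to a derivation of the quotient field $R$, so $W(A)=R\,\mathrm{Der}\,A$ (the set of all $R$-linear combinations of such extended derivations) is a $\mathbb K$-Lie subalgebra of $\mathrm{Der}\,R$ and a vector space over $R$ (it is not in general a Lie algebra over $R$). Subalgebras of $W(A)$ are $\mathbb K$-subalgebras. For a subalgebra $L\subseteq W(A)$: $RL$ is the $R$-span of $L$ and the rank of $L$ over $R$ is $\mathrm{rk}_R L=\dim_R RL$; the field of constants of $L$ is $F(L)=\{r\in R \mid D(r)=0 \text{ for all } D\in L\}$, a subfield of $R$; $FL$ is the $F$-span of $L$ in $W(A)$, which is a Lie algebra over $F=F(L)$. $F\langle\ldots\rangle$ denotes the linear span over $F$ of the listed elements.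
   Formalization: In part 2, when K has characteristic p > 0, it is additionally assumed that dim_F FL ≤ p+1; without this the claim fails, since a^k/k! makes sense only for k < p. In characteristic 0 nothing is added. *)

(* Defs.v *)
From HB Require Import structures.
From mathcomp Require Import all_boot all_order all_algebra.
From mathcomp Require Import boolp classical_sets functions.

Set Implicit Arguments.
Unset Strict Implicit.
Unset Printing Implicit Defensive.

Import GRing.Theory.
Local Open Scope classical_set_scope.
Local Open Scope ring_scope.

#[short(type="idomainAlgType")]
HB.structure Definition IdomainAlgebra (K : pzRingType) :=
  {A of GRing.IntegralDomain A & GRing.Algebra K A}.

(* No vectType here: the ambient module of maps R -> R is infinite-dimensional,
   and the scalars range over a subfield of R given as a set S. *)
Section Linear.
Variables (R : nzRingType) (V : lmodType R).
Implicit Types (S : set R) (X U : set V).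

Definition lin_span S X : set V :=
  [set v | exists n (c : 'I_n -> R) (x : 'I_n -> V),
     [/\ forall i, S (c i), forall i, X (x i) & v = \sum_(i < n) c i *: x i]].

Definition lin_independent S n (b : 'I_n -> V) : Prop :=
  forall c : 'I_n -> R, (forall i, S (c i)) ->
    \sum_(i < n) c i *: b i = 0 -> forall i, c i = 0.

(* U has dimension n over S; U is meant to be an S-subspace, which the last
   clause enforces when S is a subfield. *)
Definition has_dim S U (n : nat) : Prop :=
  exists b : 'I_n -> V,
    [/\ forall i, U (b i), lin_independent S b & lin_span S (range b) = U].

End Linear.

(* K-derivations of a commutative ring B, whose K-algebra structure is given by
   the structure map iota : K -> B. *)
Definition is_derivation (K : Type) (B : comPzRingType) (iota : K -> B)
    (D : B -> B) : Prop :=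
  [/\ forall x y, D (x + y) = D x + D y,
      forall c x, D (iota c * x) = iota c * D x &
      forall x y, D (x * y) = D x * y + x * D y].

(* The regular module R^o as codomain makes these maps an R-module, with
   (r *: D) x = r * D x. *)
Notation frac_map A := ({fraction A} -> {fraction A}^o).

Section Derivations.
Variables (K : fieldType) (A : idomainAlgType K).
Local Notation R := {fraction A}.
Implicit Types (D E : frac_map A) (L : set (frac_map A)).

Definition frac_scalar (c : K) : R := tofrac (c%:A : A).

Definition der : set (A -> A) := [set d | is_derivation (in_alg A) d].

Definition extended_der : set (frac_map A) :=
  [set E | is_derivation frac_scalar (E : R -> R) /\
           exists2 d, der d & forall a : A, E (tofrac a) = tofrac (d a)].

Definition rDer : set (frac_map A) := lin_span setT extended_der.

Definition bracket D E : frac_map A := fun x => D (E x) - E (D x).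

Definition span_K (X : set (frac_map A)) : set (frac_map A) :=
  lin_span (range frac_scalar) X.

Definition lie_subalgebra L : Prop :=
  [/\ L `<=` rDer, L 0,
      forall D E, L D -> L E -> L (D + E),
      forall c D, L D -> L (frac_scalar c *: D) &
      forall D E, L D -> L E -> L (bracket D E)].

Definition commutator L M : set (frac_map A) :=
  span_K [set bracket p.1 p.2 | p in L `*` M].

Fixpoint lower_central L (n : nat) : set (frac_map A) :=
  if n is n'.+1 then commutator L (lower_central L n') else L.

Definition nilpotent_lie L : Prop := exists n, lower_central L n `<=` [set 0].

Definition abelian_lie L : Prop :=
  forall D E, L D -> L E -> bracket D E = 0.

Definition constants L : set R := [set r | forall D, L D -> D r = 0].

Definition span_R L : set (frac_map A) := lin_span setT L.

Definition has_rank L (n : nat) : Prop := has_dim setT (span_R L) n.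

Definition span_F L : set (frac_map A) := lin_span (constants L) L.

End Derivations.

(* Main.v *)
Require Import Defs.
From HB Require Import structures.
From mathcomp Require Import all_boot all_order all_algebra.
From mathcomp Require Import ring.
From mathcomp Require Import boolp classical_sets functions.

(** A nonzero nilpotent Lie algebra [L] contains a nonzero central element [Z]
(the last nonzero term of its lower central series consists of such elements,
[nilpotent_central]), and [0 = [Z, r Z] = Z(r) Z] as soon as [r Z] lies in
[L].  In rank one every element of [L] is some [r Z], and an [r] with
[Z(r) = 0] is then a constant; hence [F L = F Z].

In rank two, take [D] in [L] outside [R Z].  An element of [L] is
[f D + g Z], and centrality of [Z] gives [Z(f) = Z(g) = 0].  Moreover
[ad(D)^m (f D + g Z) = D^m(f) D + D^m(g) Z], so nilpotency makes [D] nilpotent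
on the coefficients.  The main point ([first_coord_constant]) is that [f] is a
constant: otherwise some iterated bracket [E' = f' D + g' Z] of [D] with the
given element has [D(f') = c] for a nonzero constant [c], and then
[[E', D] = - c D] modulo [R Z], so that [ad(E')] is not nilpotent.

Therefore [F L = F D + U Z], where [U] is the set of [r] with [r Z] in [F L].
The operator [D] is nilpotent on the [F]-space [U], and its kernel there is
[F], since an element killed by [D] and [Z] is a constant.  So [U] is a single
Jordan block: if [D^(k+1) = 0] on [U] and [D^k u = 1], then
[U] is spanned by [u, D u, ..., D^k u].  If [k > 0], the element
[a = D^(k-1) u] satisfies [D(a) = 1] and [Z(a) = 0], so the divided powers
[a^i / i!] form another Jordan chain above [1].  Subtracting multiples of
them shows that they span everything killed by [Z] and by a power of [D]
([ker_iter_der_span]), and the same subtraction, applied to [D^(k-i) u], puts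
them in [U] ([divided_power_Zcoef]).

The divided powers require [k!] to be invertible.  The elements [D] and
[D^i(u) Z], [i <= k], are independent over [F] ([string_dim]), so
[dim_F F L >= k + 2]; in characteristic [p] the bound [dim_F F L <= p + 1]
thus gives [k < p]. *)

Set Implicit Arguments.
Unset Strict Implicit.
Unset Printing Implicit Defensive.

Import GRing.Theory.
Local Open Scope classical_set_scope.
Local Open Scope ring_scope.

(** * Spans over a set of scalars *)

Section LinSpan.
Variables (R : nzRingType) (V : lmodType R) (S : set R).
Implicit Types (X P : set V).

Lemma lin_span_gen X x : S 1 -> X x -> lin_span S X x.
Proof.
move=> S1 Xx; exists 1%N, (fun _ => 1), (fun _ => x).
by split=> //; rewrite big_ord1 scale1r.
Qed.

Lemma lin_span_min X P :
    P 0 -> (forall v w, P v -> P w -> P (v + w)) ->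
    (forall c v, S c -> P v -> P (c *: v)) ->
  X `<=` P -> lin_span S X `<=` P.
Proof.
move=> P0 PD PZ XP _ [n [c [x [Sc Xx ->]]]].
by apply: (big_ind P) => // i _; apply: PZ => //; apply: XP.
Qed.

Lemma lin_span_mono X Y : X `<=` Y -> lin_span S X `<=` lin_span S Y.
Proof.
by move=> XY _ [n [c [x [Sc Xx ->]]]]; exists n, c, x; split=> // i; apply: XY.
Qed.

Lemma lin_span0 X : lin_span S X 0.
Proof.
exists 0%N, (fun _ => 0), (fun _ => 0).
by split=> [[]|[]|] //; rewrite big_ord0.
Qed.

Lemma lin_spanD X v w :
  lin_span S X v -> lin_span S X w -> lin_span S X (v + w).
Proof.
move=> [n [c [x [Sc Xx ->]]]] [m [d [y [Sd Xy ->]]]].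
exists (n + m)%N, (fun i => match fintype.split i with inl j => c j | inr j => d j end),
  (fun i => match fintype.split i with inl j => x j | inr j => y j end).
split=> [i|i|]; try by case: fintype.split.
rewrite big_split_ord; congr (_ + _); apply: eq_bigr => i _.
  by rewrite (unsplitK (inl i)).
by rewrite (unsplitK (inr i)).
Qed.

Lemma lin_spanZ X e v : (forall x y, S x -> S y -> S (x * y)) ->
  S e -> lin_span S X v -> lin_span S X (e *: v).
Proof.
move=> SM Se [n [c [x [Sc Xx ->]]]]; exists n, (fun i => e * c i), x.
split=> // [i|]; first exact: SM.
by rewrite scaler_sumr; apply: eq_bigr => i _; rewrite scalerA.
Qed.

End LinSpan.

(** * The exchange lemma over a subfield given as a set *)

Section Exchange.
Variables (R : fieldType).
Implicit Type S : set R.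

Definition subfield_set S : Prop :=
  [/\ S 1, forall x y, S x -> S y -> S (x - y),
      forall x y, S x -> S y -> S (x * y) & forall x, S x -> S x^-1].

Variables (S : set R) (subS : subfield_set S).

Lemma subfield0 : S 0.
Proof. by have [S1 SB _ _] := subS; rewrite -(subrr 1); apply: SB. Qed.

Lemma subfieldN x : S x -> S (- x).
Proof.
by have [_ SB _ _] := subS; rewrite -[- x]add0r; apply/SB/subfield0.
Qed.

Lemma subfieldD x y : S x -> S y -> S (x + y).
Proof.
have [_ SB _ _] := subS => Sx Sy.
by rewrite -[y]opprK; apply: SB => //; apply: subfieldN.
Qed.

(** Gaussian elimination over [S]: linear algebra over [R] only provides a kernel
vector with entries in [R], whereas independence over [S] needs entries in [S].
The induction clears one column, so that it only uses field operations of
[S]. *)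
Lemma subfield_left_kernel n m (C : 'I_m -> 'I_n -> R) :
    (n < m)%N -> (forall i j, S (C i j)) ->
  exists x : 'I_m -> R, [/\ forall i, S (x i), exists i, x i != 0
    & forall j, \sum_i x i * C i j = 0].
Proof.
have [S1 SB SM SV] := subS.
elim: n m C => [|n IH] [|m] C // lt_nm SC.
  exists (fun _ => 1); split=> [//||[] //].
  by exists ord0; rewrite oner_eq0.
have [/existsP[p Cp]|] := boolP [exists p, C p ord0 != 0]; last first.
  rewrite negb_exists => /forallP C0.
  have [x [Sx x0 xC]] := IH m.+1 (fun i j => C i (lift ord0 j)) (ltnW lt_nm)
    (fun i j => SC i _).
  exists x; split=> // j; case: (unliftP ord0 j) => [j' ->|->]; first exact: xC.
  by apply: big1 => i _; have /negPn/eqP-> := C0 i; rewrite mulr0.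
(* [p] is the pivot row; subtracting [q i] times it clears the first column. *)
pose q i := C (lift p i) ord0 / C p ord0.
have Sq i : S (q i) by apply: SM => //; apply: SV.
pose C' i j := C (lift p i) (lift ord0 j) - q i * C p (lift ord0 j).
have [i j|x [Sx [i0 xi0] xC]] := IH m C' lt_nm.
  by apply: SB => //; apply: SM.
pose y i := if unlift p i is Some i' then x i' else - \sum_i x i * q i.
have yp : y p = - \sum_i x i * q i by rewrite /y unlift_none.
have yl i : y (lift p i) = x i by rewrite /y liftK.
exists y; split=> [i||j].
- case: (unliftP p i) => [i' ->|->]; rewrite ?yl // yp; apply: subfieldN.
  by apply: (big_ind S); [exact: subfield0|exact: subfieldD|move=> *; apply: SM].
- by exists (lift p i0); rewrite yl.
- rewrite (bigD1_ord p) //= yp mulNr mulr_suml.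
  under [X in _ + X]eq_bigr do rewrite yl.
  rewrite -sumrN -big_split /=.
  case: (unliftP ord0 j) => [j' ->|->].
    rewrite -[RHS](xC j'); apply: eq_bigr => i _; rewrite /C'; ring.
  by apply: big1 => i _; rewrite /q; field.
Qed.

Variable V : lmodType R.

Lemma lin_span_range m (c : 'I_m -> V) v : lin_span S (range c) v ->
  exists2 e : 'I_m -> R, forall j, S (e j) & v = \sum_j e j *: c j.
Proof.
have [S1 SB SM SV] := subS; move: v; apply: lin_span_min.
- exists (fun _ => 0) => [_|]; first exact: subfield0.
  by rewrite big1 // => j _; rewrite scale0r.
- move=> _ _ [e Se ->] [d Sd ->]; exists (fun j => e j + d j) => [j|].
    exact: subfieldD.
  by rewrite -big_split; apply: eq_bigr => j _; rewrite scalerDl.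
- move=> a _ Sa [e Se ->]; exists (fun j => a * e j) => [j|]; first exact: SM.
  by rewrite scaler_sumr; apply: eq_bigr => j _; rewrite scalerA.
- move=> _ [j _ <-]; exists (fun i => (i == j)%:R) => [i|].
    by case: eqP => _; [exact: S1 | exact: subfield0].
  rewrite (bigD1 j) //= eqxx scale1r big1 ?addr0 // => i /negPf->.
  by rewrite scale0r.
Qed.

Lemma lin_independent_leq n m (b : 'I_n -> V) (c : 'I_m -> V) :
    lin_independent S b -> (forall i, lin_span S (range c) (b i)) ->
  (n <= m)%N.
Proof.
move=> bfree bc; rewrite leqNgt; apply/negP => lt_mn.
have /choice[C bC] i : exists e : 'I_m -> R,
    (forall j, S (e j)) /\ b i = \sum_j e j *: c j.
  by have [e ? ?] := lin_span_range (bc i); exists e.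
have [x [Sx [i xi] xC]] := subfield_left_kernel lt_mn (fun i => (bC i).1).
case/eqP: xi; apply: (bfree x) => //.
under eq_bigr => k _ do rewrite (bC k).2 scaler_sumr.
rewrite exchange_big big1 // => j _.
under eq_bigr do rewrite scalerA.
by rewrite -scaler_suml xC scale0r.
Qed.

End Exchange.

(** * Derivations of the fraction field *)

Section Derivations.
Variables (K : fieldType) (A : idomainAlgType K).
Local Notation R := {fraction A}.
Local Notation W := (frac_map A).
Implicit Types (D E Z : W) (L : set W).
Local Notation derivation D := (is_derivation (@frac_scalar K A) (D : R -> R)).

Section Calculus.
Variables (D : W) (dD : derivation D).

Lemma derD x y : D (x + y) = D x + D y. Proof. by case: dD. Qed.

Lemma derM x y : D (x * y) = D x * y + x * D y. Proof. by case: dD. Qed.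

Lemma der0 : D 0 = 0.
Proof. by apply: (addrI (D 0)); rewrite -derD !addr0. Qed.

Lemma derN x : D (- x) = - D x.
Proof. by apply: (addrI (D x)); rewrite -derD !subrr der0. Qed.

Lemma derB x y : D (x - y) = D x - D y.
Proof. by rewrite derD derN. Qed.

Lemma der1 : D 1 = 0.
Proof. by apply: (addrI (D 1)); rewrite -{3}(mulr1 1) derM mulr1 mul1r addr0. Qed.

Lemma derV x : D x = 0 -> D x^-1 = 0.
Proof.
have [->|x0 Dx] := eqVneq x 0; first by rewrite invr0 der0.
apply: (mulfI x0); rewrite mulr0.
by have := derM x x^-1; rewrite divff // der1 Dx mul0r add0r.
Qed.

Lemma der_scale c x : D c = 0 -> D (c * x) = c * D x.
Proof. by move=> Dc; rewrite derM Dc mul0r add0r. Qed.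

Lemma der_natr n : D n%:R = 0.
Proof. by elim: n => [|n IH]; rewrite ?der0 // mulrS derD der1 IH addr0. Qed.

Lemma iter_derB n x y : iter n D (x - y) = iter n D x - iter n D y.
Proof. by elim: n => //= n ->; rewrite derB. Qed.

Lemma iter_derD n x y : iter n D (x + y) = iter n D x + iter n D y.
Proof. by elim: n => //= n ->; rewrite derD. Qed.

Lemma iter_der0 n : iter n D 0 = 0.
Proof. by elim: n => //= n ->; rewrite der0. Qed.

Lemma iter_der_scale n c x : D c = 0 -> iter n D (c * x) = c * iter n D x.
Proof. by move=> Dc; elim: n => //= n ->; rewrite der_scale. Qed.

Lemma der_expn a n : D a = 1 -> D (a ^+ n) = n%:R * a ^+ n.-1.
Proof.
move=> Da; elim: n => [|[|n] IH]; first by rewrite expr0 der1 mul0r.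
  by rewrite expr1 Da expr0 mulr1.
by rewrite exprS derM Da IH /= [in RHS]mulrS mulrDl !mul1r mulrCA -exprS.
Qed.

Lemma der_divided_power a i : D a = 1 -> (i.+1)`!%:R != 0 :> R ->
  D (a ^+ i.+1 / (i.+1)`!%:R) = a ^+ i / i`!%:R.
Proof.
move=> Da; rewrite factS natrM mulf_eq0 negb_or => /andP[i0 f0].
rewrite mulrC der_scale; last by rewrite derV // -natrM der_natr.
by rewrite (der_expn _ Da) invfM mulrAC mulKf.
Qed.

Lemma iter_der_divided_power a i : D a = 1 -> i`!%:R != 0 :> R ->
  iter i D (a ^+ i / i`!%:R) = 1.
Proof.
move=> Da; elim: i => [|i IH] fi; first by rewrite expr0 fact0 divr1.
rewrite iterSr (der_divided_power Da fi); apply: IH.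
by apply: contraNneq fi => f0; rewrite factS natrM f0 mulr0.
Qed.

End Calculus.

Lemma derivation_lincomb D E f g :
  derivation D -> derivation E -> derivation (f *: D + g *: E).
Proof.
move=> [DD DZ DM] [ED EZ EM]; split=> [x y|c x|x y].
- change (f * D (x + y) + g * E (x + y) = f * D x + g * E x + (f * D y + g * E y)).
  by rewrite DD ED; ring.
- change (f * D (frac_scalar A c * x) + g * E (frac_scalar A c * x) =
    frac_scalar A c * (f * D x + g * E x)).
  by rewrite DZ EZ; ring.
- change (f * D (x * y) + g * E (x * y) =
    (f * D x + g * E x) * y + x * (f * D y + g * E y)).
  by rewrite DM EM; ring.
Qed.

Lemma derivation0 : derivation (0 : W).
Proof.
split=> [x y|c x|x y]; change ((0 : W) _) with (0 : R) => /=.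
- by rewrite addr0.
- by rewrite mulr0.
- by rewrite mul0r mulr0 addr0.
Qed.

Lemma rDer_derivation D : rDer D -> derivation D.
Proof.
move: D; apply: lin_span_min => [|D E dD dE|c D _ dD|D [] //].
- exact: derivation0.
- by rewrite -[D]scale1r -[E]scale1r; apply: derivation_lincomb.
- by rewrite -[c *: D]addr0 -(scale0r D); apply: derivation_lincomb.
Qed.

Lemma bracket_lincomb D E f g F : derivation D ->
  bracket D (f *: E + g *: F) =
  D f *: E + f *: bracket D E + (D g *: F + g *: bracket D F).
Proof.
move=> dD; apply/funext => x.
have distr (f' e de ed g' y dy yd : R) :
    f' * e + f * de + (g' * y + g * dy) - (f * ed + g * yd) =
    f' * e + f * (de - ed) + (g' * y + g * (dy - yd)) by ring.
change (D (f * E x + g * F x) - (f * E (D x) + g * F (D x)) =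
  D f * E x + f * (D (E x) - E (D x)) + (D g * F x + g * (D (F x) - F (D x)))).
by rewrite (derD dD) !(derM dD); apply: distr.
Qed.

Lemma bracketC D E : bracket D E = - bracket E D.
Proof.
by apply/funext => x; change (D (E x) - E (D x) = - (E (D x) - D (E x))); rewrite opprB.
Qed.

Lemma bracket_scale D E f : derivation D ->
  bracket D (f *: E) = D f *: E + f *: bracket D E.
Proof.
move=> dD; have := bracket_lincomb E f 0 E dD.
by rewrite (der0 dD) !scale0r !addr0.
Qed.

Lemma bracketxx D : bracket D D = 0.
Proof. by apply/funext => x; apply: subrr. Qed.

Lemma bracket_commute D E : bracket D E = 0 -> forall x, D (E x) = E (D x).
Proof.
by move=> DE x; apply/eqP; rewrite -subr_eq0; apply/eqP/(congr1 (fun G : W => G x) DE).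
Qed.

(** * Nilpotent subalgebras *)

Section Nilpotent.
Variables (L : set W) (subL : lie_subalgebra L).

Lemma subalgebra_derivation D : L D -> derivation D.
Proof. by case: subL => LR _ _ _ _ LD; apply/rDer_derivation/LR. Qed.

Lemma constants_subfield : subfield_set (constants L).
Proof.
split=> [D /subalgebra_derivation|x y Fx Fy D LD|x y Fx Fy D LD|x Fx D LD].
- exact: der1.
- by rewrite (derB (subalgebra_derivation LD)) Fx // Fy // subrr.
- by rewrite (der_scale (subalgebra_derivation LD) _ (Fx D LD)) Fy // mulr0.
- by apply: derV; [apply: subalgebra_derivation | apply: Fx].
Qed.

Lemma commutator_bracket M D E : L D -> M E -> commutator L M (bracket D E).
Proof.
move=> LD ME; apply: lin_span_gen; last by exists (D, E).
by exists 1 => //; rewrite /frac_scalar scale1r rmorph1.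
Qed.

Lemma iter_bracket_lower_central n D E : L D -> L E ->
  lower_central L n (iter n (bracket D) E).
Proof. by move=> LD LE; elim: n => //= n IH; apply: commutator_bracket. Qed.

Lemma lower_central_sub n : lower_central L n `<=` L.
Proof.
have [_ L0 LD LZ LB] := subL.
elim: n => // n IH; apply: lin_span_min => //.
  by move=> _ D [c _ <-]; apply: LZ.
by move=> _ [[D E] [/= LD' /IH LE] <-]; apply: LB.
Qed.

(** The last nonzero term of the lower central series is central. *)
Lemma nilpotent_central D : nilpotent_lie L -> L D -> D != 0 ->
  exists Z, [/\ L Z, Z != 0 & forall E, L E -> bracket E Z = 0].
Proof.
move=> [n Ln] LD D0.
have exP : exists n, `[< lower_central L n `<=` [set 0] >].
  by exists n; apply/asboolP.
case: (ex_minnP exP) => -[/asboolP /(_ D LD) /= /eqP|m /asboolP Lm min_m].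
  by rewrite (negPf D0).
have [Z LmZ Z0] : exists2 Z, lower_central L m Z & Z != 0.
  apply: contrapT => noZ; suff /min_m : `[< lower_central L m `<=` [set 0] >].
    by rewrite ltnn.
  by apply/asboolP => E LE; apply/eqP/negP => /negP E0; apply: noZ; exists E.
exists Z; split=> // [|E LE]; first exact: lower_central_sub LmZ.
exact/Lm/commutator_bracket.
Qed.

End Nilpotent.

(** * Rank over the fraction field *)

Section Rank.
Variables (L : set W) (n : nat).
Hypothesis rankL : has_rank L n.

Let subT : subfield_set (setT : set R). Proof. by []. Qed.

Lemma has_rank_leq m (c : 'I_m -> W) :
  L `<=` lin_span setT (range c) -> (n <= m)%N.
Proof.
have [b [Lb bfree _]] := rankL => Lc.
apply: (lin_independent_leq subT bfree (c := c)) => i.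
move: (b i) (Lb i); apply: lin_span_min => //.
- exact: lin_span0.
- by move=> *; apply: lin_spanD.
- by move=> *; apply: lin_spanZ.
Qed.

(** Otherwise [E] together with [v] would be [n + 1] independent elements in a
span of dimension [n]. *)
Lemma has_rank_gen (v : 'I_n -> W) E :
    (forall i, L (v i)) -> lin_independent setT v -> L E ->
  lin_span setT (range v) E.
Proof.
have [b [_ _ spanb]] := rankL => Lv vfree LE; apply: contrapT => nE.
pose w (i : 'I_n.+1) := if unlift ord0 i is Some j then v j else E.
suff : (n.+1 <= n)%N by rewrite ltnn.
apply: (lin_independent_leq subT (b := w) (c := b)) => [c _|i]; last first.
  by rewrite spanb /w; apply: lin_span_gen => //; case: unliftP.
rewrite big_ord_recl {1}/w unlift_none => sum0.
have eqw : \sum_i c (lift ord0 i) *: w (lift ord0 i) =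
    \sum_i c (lift ord0 i) *: v i.
  by apply: eq_bigr => i _; rewrite /w liftK.
have c0 : c ord0 = 0.
  apply: contrapT => /eqP c0; apply: nE.
  exists n, (fun i => - (c ord0)^-1 * c (lift ord0 i)), v.
  split=> //.
  apply: (scalerI c0); rewrite scaler_sumr.
  under eq_bigr do rewrite scalerA mulrA mulrN (mulfV c0) mulN1r scaleNr.
  by rewrite sumrN -eqw; apply/eqP; rewrite -addr_eq0 sum0.
move: sum0; rewrite c0 scale0r add0r eqw => sum0 i.
case: (unliftP ord0 i) => [j ->|->] //.
exact: (vfree (fun j => c (lift ord0 j))).
Qed.

End Rank.

Lemma has_rank_nonzero L n : has_rank L n.+1 -> exists2 D, L D & D != 0.
Proof.
move=> rankL; apply: contrapT => L0.
suff /(has_rank_leq rankL) : L `<=` lin_span setT (range (fun _ : 'I_0 => 0)) by [].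
move=> E LE; have [->|E0] := eqVneq E 0; first exact: lin_span0.
by case: L0; exists E.
Qed.

Lemma has_rank1_gen L D E : has_rank L 1 -> L D -> D != 0 -> L E ->
  exists r : R, E = r *: D.
Proof.
move=> rankL LD D0 LE.
have [//||c _ ->] := @lin_span_range _ setT _ _ 1 (fun _ => D) E; last first.
  by exists (c ord0); rewrite big_ord1.
apply: (has_rank_gen rankL) => // c _; rewrite big_ord1 => /eqP.
by rewrite scaler_eq0 (negPf D0) orbF => /eqP c0 i; rewrite ord1.
Qed.

Lemma has_rank2_basis L Z : has_rank L 2 -> L Z -> Z != 0 ->
  exists D, [/\ L D,
    forall f g : R, f *: D + g *: Z = 0 -> f = 0 /\ g = 0 &
    forall E, L E -> exists f g : R, E = f *: D + g *: Z].
Proof.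
move=> rankL LZ Z0.
have [D LD nD] : exists2 D, L D & forall r : R, D <> r *: Z.
  apply: contrapT => noD.
  suff /(has_rank_leq rankL) : L `<=` lin_span setT (range (fun _ : 'I_1 => Z)) by [].
  move=> E LE; apply: contrapT => nE; apply: noD; exists E => // r Er; apply: nE.
  by exists 1%N, (fun _ => r), (fun _ => Z); split=> // [i|]; [exists i | rewrite big_ord1].
have free f g : f *: D + g *: Z = 0 -> f = 0 /\ g = 0.
  have [->|f0 fg] := eqVneq f 0.
    by rewrite scale0r add0r => /eqP; rewrite scaler_eq0 (negPf Z0) orbF => /eqP.
  case: (nD (- f^-1 * g)); apply: (scalerI f0).
  rewrite scalerA mulrA mulrN mulfV // mulN1r scaleNr.
  by apply/eqP; rewrite -addr_eq0 fg.
exists D; split=> // E LE.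
pose v (i : 'I_2) := if i == ord0 then D else Z.
have [//||c _ ->] := @lin_span_range _ setT _ _ 2 v E; last first.
  by exists (c ord0), (c (lift ord0 ord0)); rewrite big_ord_recl big_ord1.
apply: (has_rank_gen rankL) => // [i|c _]; first by rewrite /v; case: ifP.
rewrite big_ord_recl big_ord1 => /free[c0 c1] i.
by case: (unliftP ord0 i) => [j ->|-> //]; rewrite ord1.
Qed.

(** * Nilpotent subalgebras of rank two *)

Section RankTwo.
Variables (L : set W) (D Z : W) (n : nat).
Hypotheses (subL : lie_subalgebra L) (Ln : lower_central L n `<=` [set 0]).
Hypotheses (LD : L D) (LZ : L Z).
Hypothesis (LZ0 : forall E, L E -> bracket E Z = 0).
Hypothesis free_DZ : forall f g : R, f *: D + g *: Z = 0 -> f = 0 /\ g = 0.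
Hypothesis gen_DZ : forall E, L E -> exists f g : R, E = f *: D + g *: Z.
Local Notation F := (constants L).

Let dD : derivation D := subalgebra_derivation subL LD.
Let dZ : derivation Z := subalgebra_derivation subL LZ.
Let DZ0 : bracket D Z = 0 := LZ0 LD.

Let coord_inj f g f' g' :
  f *: D + g *: Z = f' *: D + g' *: Z -> f = f' /\ g = g'.
Proof.
move=> e; have [] := free_DZ (f := f - f') (g := g - g').
  by rewrite !scalerBl addrACA e -opprD subrr.
by move=> /eqP; rewrite subr_eq0 => /eqP-> /eqP; rewrite subr_eq0 => /eqP->.
Qed.

(* [D] and [Z] generate [L] over [R], so they detect the constants. *)
Let constantP r : F r <-> D r = 0 /\ Z r = 0.
Proof.
split=> [Fr|[Dr Zr] E /gen_DZ[f [g ->]]]; first by split; apply: Fr.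
by change (f * D r + g * Z r = 0); rewrite Dr Zr !mulr0 addr0.
Qed.

Let Z_iter m r : Z (iter m D r) = iter m D (Z r).
Proof. by elim: m => //= m <-; rewrite (bracket_commute DZ0). Qed.

Let iter_bracket_coord m f g :
  iter m (bracket D) (f *: D + g *: Z) = iter m D f *: D + iter m D g *: Z.
Proof.
elim: m => //= m ->.
by rewrite (bracket_lincomb _ _ _ _ dD) bracketxx DZ0 !scaler0 !addr0.
Qed.

Let nil_bracket E E' : L E -> L E' -> iter n (bracket E) E' = 0.
Proof. by move=> LE LE'; apply/Ln/iter_bracket_lower_central. Qed.

(** [ad Z] differentiates the coordinates by [Z], and [ad D] by [D]; the first
vanishes on [L] and the second is nilpotent. *)
Lemma central_coord E : L E -> exists f g : R,
  [/\ E = f *: D + g *: Z, Z f = 0, Z g = 0, iter n D f = 0 & iter n D g = 0].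
Proof.
move=> LE; have [f [g Efg]] := gen_DZ LE; exists f, g.
have ZE : bracket Z E = 0 by rewrite bracketC LZ0 ?oppr0.
move: ZE; rewrite Efg (bracket_lincomb _ _ _ _ dZ) bracketxx bracketC DZ0.
rewrite oppr0 !scaler0 !addr0 => /free_DZ[Zf Zg].
have := nil_bracket LD LE; rewrite Efg iter_bracket_coord => /free_DZ[Df Dg].
by [].
Qed.

(** If [D f] were nonzero, replacing the element by an iterated bracket with [D]
would give [E' = f' D + g' Z] in [L] with [c = D f'] a nonzero constant.  Then
[ad E'] multiplies a constant [D]-coordinate by [- c], so no power of it
kills [D]. *)
Lemma first_coord_constant E : L E -> exists f g : R,
  [/\ E = f *: D + g *: Z, F f, Z g = 0 & iter n D g = 0].
Proof.
move=> LE; have [f [g [Efg Zf Zg Df Dg]]] := central_coord LE.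
exists f, g; split=> //; apply/constantP; split=> //.
apply: contrapT => /eqP Df0.
have exP : exists m, iter m D f == 0 by exists n; rewrite Df.
(* The least exponent killing [f] is at least 2, hence of the form [m + 2]. *)
case: (ex_minnP exP) => -[|[|m]] /eqP /=.
- by move=> f0; rewrite f0 (der0 dD) eqxx in Df0.
- by move/eqP; rewrite (negPf Df0).
move=> Dc min_m; pose f' := iter m D f; pose g' := iter m D g; pose c := D f'.
have c0 : c != 0 by apply/negP => /(min_m m.+1); rewrite ltnn.
have Dc0 : D c = 0 := Dc.
have Fc : F c.
  by apply/constantP; split=> //; rewrite /c -/(iter m.+1 D f) Z_iter Zf iter_der0.
pose E' := f' *: D + g' *: Z.
have LE' : L E'.
  rewrite /E' -iter_bracket_coord -Efg.
  by apply: (lower_central_sub subL (n := m)); apply: iter_bracket_lower_central.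
have dE' := subalgebra_derivation subL LE'.
have E'D : bracket E' D = - c *: D - D g' *: Z.
  rewrite bracketC (bracket_lincomb _ _ _ _ dD) bracketxx DZ0.
  by rewrite !scaler0 !addr0 opprD scaleNr.
have E'iter j : exists h : R,
    iter j (bracket E') D = (- c) ^+ j *: D + h *: Z.
  elim: j => [|j [h IH]] /=.
    by exists 0; rewrite expr0 scale1r scale0r addr0.
  exists (E' h - (- c) ^+ j * D g'); rewrite IH (bracket_lincomb _ _ _ _ dE').
  have E'c : E' ((- c) ^+ j) = 0.
    elim: j {IH} => [|j IHj]; first by rewrite expr0 (der1 dE').
    rewrite exprS (der_scale dE') ?IHj ?mulr0 // (derN dE') Fc ?oppr0 //.
  rewrite E'c (LZ0 LE') E'D scale0r add0r scaler0 addr0 scalerDr scalerA.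
  by rewrite -exprSr scalerN scalerA -addrA scalerBl [X in _ + X]addrC.
have [h] := E'iter n; rewrite (nil_bracket LE' LD) => /esym/free_DZ[/eqP].
by rewrite expf_eq0 oppr_eq0 (negPf c0) andbF.
Qed.


Let subF : subfield_set F := constants_subfield subL.

Let F1 : F 1. Proof. by case: subF. Qed.

Let FM x y : F x -> F y -> F (x * y). Proof. by case: subF => _ _ + _; apply. Qed.

Let F0 : F 0 := subfield0 subF.

Let der_constM c x : F c -> D (c * x) = c * D x.
Proof. by move=> Fc; rewrite (der_scale dD) //; apply: Fc. Qed.

Let iter_der_constM m c x : F c -> iter m D (c * x) = c * iter m D x.
Proof. by move=> Fc; rewrite (iter_der_scale dD) //; apply: Fc. Qed.

Let Z_constM c x : F c -> Z (c * x) = c * Z x.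
Proof. by move=> Fc; rewrite (der_scale dZ) //; apply: Fc. Qed.

Let span_F_Z c E : F c -> span_F L E -> span_F L (c *: E).
Proof. exact: lin_spanZ. Qed.

(** The ideal of [span_F L] formed by its elements proportional to [Z],
seen through the coefficient of [Z]. *)
Definition Zcoef : set R := [set r | span_F L (r *: Z)].
Local Notation U := Zcoef.

Let UD r s : U r -> U s -> U (r + s).
Proof. by move=> Ur Us; rewrite /U /= scalerDl; apply: lin_spanD. Qed.

Let UZ c r : F c -> U r -> U (c * r).
Proof. by move=> Fc Ur; rewrite /U /= -scalerA; apply: span_F_Z. Qed.

Let U1 : U 1.
Proof. by rewrite /U /= scale1r; apply: lin_span_gen. Qed.

(** The conditions on [f] and [g] hold on [L] and are stable under [F]-linear
combinations; [U (D g)] comes from [[D, f D + g Z] = D(g) Z]. *)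
Lemma span_F_coord E : span_F L E -> exists f g : R,
  [/\ E = f *: D + g *: Z, F f, Z g = 0, iter n D g = 0 & U g /\ U (D g)].
Proof.
move: E; apply: lin_span_min => [|E E' [f [g [-> Ff Zg Dg [Ug UDg]]]]
    [f' [g' [-> Ff' Zg' Dg' [Ug' UDg']]]]|c E Fc [f [g [-> Ff Zg Dg [Ug UDg]]]]|E LE].
- exists 0, 0; rewrite !scale0r addr0 (der0 dZ) (der0 dD) iter_der0 //.
  by split=> //; split; rewrite /U /= scale0r; apply: lin_span0.
- exists (f + f'), (g + g'); rewrite !scalerDl addrACA (derD dZ) (derD dD).
  rewrite (iter_derD dD) Zg Zg' Dg Dg' addr0; split=> //.
    exact: (subfieldD subF).
  by split; apply: UD.
- exists (c * f), (c * g); rewrite scalerDr !scalerA Z_constM // der_constM //.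
  rewrite iter_der_constM // Zg Dg mulr0.
  by split=> //; [apply: FM | split; apply: UZ].
- have [f [g [Efg Ff Zg Dg]]] := first_coord_constant LE.
  exists f, g; split=> //; split; rewrite /U /=.
    have -> : g *: Z = E + (- f) *: D by rewrite Efg scaleNr addrAC subrr add0r.
    apply: lin_spanD; first exact: lin_span_gen.
    by apply: span_F_Z; [apply: (subfieldN subF) | apply: lin_span_gen].
  have -> : D g *: Z = bracket D E.
    have := iter_bracket_coord 1 f g; rewrite /= Efg => ->.
    by rewrite Ff // scale0r add0r.
  by apply: lin_span_gen => //; case: subL => _ _ _ _; apply.
Qed.

Lemma Zcoef_der r : U r -> [/\ Z r = 0, iter n D r = 0 & U (D r)].
Proof.
move=> /span_F_coord[f [g [e _ Zg Dg [_ UDg]]]].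
have [_ ->] : 0 = f /\ r = g by apply: coord_inj; rewrite scale0r add0r.
by [].
Qed.

Let Uiter m r : U r -> U (iter m D r).
Proof. by move=> Ur; elim: m => //= m /Zcoef_der[]. Qed.

(** [k + 1] is the nilpotency index of [D] on [U].  The top iterate of a suitable
element is a nonzero constant, by which one divides. *)
Lemma Zcoef_cyclic : exists k (u : R),
  [/\ U u, iter k D u = 1 & forall r, U r -> iter k.+1 D r = 0].
Proof.
have exP : exists m, `[< forall r, U r -> iter m D r = 0 >].
  by exists n; apply/asboolP => r /Zcoef_der[].
case: (ex_minnP exP) => -[/asboolP /(_ 1 U1) /= /eqP|k /asboolP Uk min_k].
  by rewrite oner_eq0.
have [r Ur Dr] : exists2 r, U r & iter k D r != 0.
  apply: contrapT => noU; suff /min_k : `[< forall r, U r -> iter k D r = 0 >].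
    by rewrite ltnn.
  by apply/asboolP => r Ur; apply/eqP/negP => /negP Dr; apply: noU; exists r.
have Fc : F (iter k D r)^-1.
  have [_ _ _] := subF; apply; apply/constantP; split; first exact: Uk.
  by rewrite Z_iter; have [-> _ _] := Zcoef_der Ur; rewrite iter_der0.
exists k, ((iter k D r)^-1 * r); split=> //; first exact: UZ.
by rewrite iter_der_constM // mulVf.
Qed.

Lemma divided_power_Z a i : Z a = 0 -> Z (a ^+ i / i`!%:R) = 0.
Proof.
move=> Za.
have Zai : Z (a ^+ i) = 0.
  by elim: i => [|i IH]; rewrite ?(der1 dZ) // exprS (der_scale dZ) // IH mulr0.
by rewrite (der_scale dZ) // (derV dZ) ?mulr0 // (der_natr dZ).
Qed.

(** Subtracting [c * a ^+ j / j!], where the constant [c] is the [j]-th iterate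
of [r], lowers the exponent that kills [r]. *)
Lemma ker_iter_der_span a j (r : R^o) : D a = 1 -> Z a = 0 ->
    (forall i, (i < j)%N -> i`!%:R != 0 :> R) ->
    Z r = 0 -> iter j D r = 0 ->
  lin_span F [set (a ^+ i / i`!%:R : R^o) | i in [set i | (i < j)%N]] r.
Proof.
move=> Da Za; elim: j r => [|j IH] r fj Zr Dr.
  by rewrite (Dr : r = 0); apply: lin_span0.
have Fc : F (iter j D r) by apply/constantP; rewrite Z_iter Zr iter_der0.
pose p : R^o := a ^+ j / j`!%:R.
rewrite -(subrK (iter j D r *: p) r); apply: lin_spanD.
  apply: (@lin_span_mono _ _ _ [set (a ^+ i / i`!%:R : R^o) | i in [set i | (i < j)%N]]).
    by move=> _ [i /= ij <-]; exists i => //=; apply: ltnW.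
  apply: IH => [i ij||]; first by apply: fj; apply: ltnW.
    by rewrite (derB dZ) Zr Z_constM // divided_power_Z // mulr0 subr0.
  rewrite (iter_derB dD) iter_der_constM // (iter_der_divided_power dD) ?fj //.
  by rewrite mulr1 subrr.
apply: lin_spanZ => //; apply: lin_span_gen => //; by exists j => /=.
Qed.

Section Cyclic.
Variables (k : nat) (u : R).
Hypotheses (Uu : U u) (Dku : iter k D u = 1).
Hypothesis UDk : forall r, U r -> iter k.+1 D r = 0.

(** Applying [D ^ (k - i)] to the relation isolates [e i]: the later terms die
because they are iterated more than [k] times, and the earlier coefficients
vanish by induction. *)
Lemma string_free (e : 'I_k.+1 -> R) : (forall i, F (e i)) ->
  \sum_i e i * iter i D u = 0 -> forall i, e i = 0.
Proof.
move=> Fe sum0 i; have [m] := ubnP (i : nat); elim: m i => // m IH i.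
rewrite ltnS => le_im.
have sumD : iter (k - i) D (\sum_j e j * iter j D u) =
    \sum_j e j * iter (k - i + j) D u.
  rewrite (big_morph (iter (k - i) D) (iter_derD dD _) (iter_der0 dD _)).
  by apply: eq_bigr => j _; rewrite iter_der_constM // iterD.
have := sumD; rewrite sum0 iter_der0 // (bigD1 i) //= subnK; last exact: ltn_ord i.
rewrite Dku mulr1 big1 ?addr0 // => j ij.
have [lt_ji|] := ltnP j i; first by rewrite (IH j) ?mul0r // (leq_trans lt_ji).
rewrite leq_eqVlt eq_sym (inj_eq val_inj) (negPf ij) /= => lt_ij.
suff -> : iter (k - i + j) D u = 0 by rewrite mulr0.
rewrite -(subnK (_ : k < k - i + j)%N) ?iterD ?UDk ?iter_der0 //.
by rewrite -[X in (X < _)%N](subnK (_ : i <= k)%N) ?ltn_add2l // -ltnS.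
Qed.

Lemma string_dim m : has_dim F (span_F L) m -> (k.+2 <= m)%N.
Proof.
move=> [b [_ _ spanb]].
(* Index 0 carries [D], the others the Jordan chain of coefficients of [Z]. *)
pose v (i : 'I_k.+2) : W :=
  if unlift ord0 i is Some j then iter (j : 'I_k.+1) D u *: Z else D.
apply: (lin_independent_leq subF (b := v) (c := b)) => [c Fc|i].
  rewrite big_ord_recl {1}/v unlift_none.
  under eq_bigr do rewrite /v liftK scalerA.
  rewrite -scaler_suml => /free_DZ[c0 /string_free cS] i.
  case: (unliftP ord0 i) => [j ->|->] //.
  by apply: cS => j'; apply: Fc.
rewrite spanb /v; case: unliftP => [j _|_]; last exact: lin_span_gen.
exact: Uiter.
Qed.

(** The element [D ^ (k - i) u] of [U] agrees with [a ^+ i / i!] modulo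
the kernel of the [i]-th iterate, which is spanned by lower divided powers. *)
Lemma divided_power_Zcoef a i : D a = 1 -> Z a = 0 ->
  (forall i, (i <= k)%N -> i`!%:R != 0 :> R) -> (i <= k)%N ->
  U (a ^+ i / i`!%:R).
Proof.
move=> Da Za fk; have [m] := ubnP i; elim: m i => // m IH i.
rewrite ltnS => le_im le_ik.
pose r := iter (k - i) D u; pose p := a ^+ i / i`!%:R.
have Ur : U r by apply: Uiter.
suff : U (r - p).
  move=> Urp; rewrite -/p -(subKr r p); apply: UD => //.
  by rewrite -mulN1r; apply: UZ => //; apply: (subfieldN subF).
have [Zr _ _] := Zcoef_der Ur.
have : lin_span F [set (a ^+ i / i`!%:R : R^o) | i in [set l | (l < i)%N]] (r - p).
  apply: ker_iter_der_span => // [l li||]; first by rewrite fk // ltnW // (leq_trans li).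
    by rewrite (derB dZ) Zr divided_power_Z ?subr0.
  by rewrite (iter_derB dD) (iter_der_divided_power dD) ?fk // -iterD subnKC // Dku subrr.
apply: lin_span_min => // [|_ [l /= li <-]].
  by rewrite /U /= scale0r; apply: lin_span0.
by apply: IH; rewrite ?(leq_trans li) // ltnW // (leq_trans li).
Qed.

Lemma span_F_divided_powers a : D a = 1 -> Z a = 0 ->
    (forall i, (i <= k)%N -> i`!%:R != 0 :> R) ->
  span_F L = lin_span F
    ([set (a ^+ i / i`!%:R) *: Z | i in [set i | (i <= k)%N]] `|` [set D]).
Proof.
move=> Da Za fk; rewrite eqEsubset; split=> [E /span_F_coord|].
  move=> [f [g [-> Ff Zg _ [Ug _]]]]; apply: lin_spanD.
    by apply: lin_spanZ => //; apply: lin_span_gen => //; right.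
  have := ker_iter_der_span (j := k.+1) Da Za fk Zg (UDk Ug).
  pose X := [set (a ^+ i / i`!%:R) *: Z | i in [set i | (i <= k)%N]] `|` [set D].
  apply: (@lin_span_min _ R^o _ _ [set h : R^o | lin_span F X ((h : R) *: Z)])
    => [|h h' Ph Ph'|c h Fc Ph|_ [i ik <-]] /=.
  - by rewrite scale0r; apply: lin_span0.
  - by rewrite scalerDl; apply: lin_spanD.
  - by rewrite -scalerA; apply: lin_spanZ.
  - by apply: lin_span_gen => //; left; exists i.
apply: lin_span_min => [|E E'|c E|E [[i ik <-]|->]].
- exact: lin_span0.
- exact: lin_spanD.
- exact: span_F_Z.
- exact: divided_power_Zcoef.
- exact: lin_span_gen.
Qed.

Lemma span_F_plane : k = 0%N -> span_F L = lin_span F [set Z; D].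
Proof.
move=> k0; rewrite eqEsubset; split=> [E /span_F_coord|].
  move=> [f [g [-> Ff Zg _ [Ug _]]]].
  have Fg : F g by apply/constantP; split=> //; have := UDk Ug; rewrite k0.
  by apply: lin_spanD; apply: lin_spanZ => //; apply: lin_span_gen => //; [right|left].
apply: lin_span_min => [|E E'|c E|E [->|->]].
- exact: lin_span0.
- exact: lin_spanD.
- exact: span_F_Z.
- exact: lin_span_gen.
- exact: lin_span_gen.
Qed.

End Cyclic.

End RankTwo.

(** * The structure theorem *)

Lemma rank1_abelian L : lie_subalgebra L -> nilpotent_lie L -> has_rank L 1 ->
  abelian_lie L /\ has_dim (constants L) (span_F L) 1.
Proof.
move=> subL nilL rankL; have subF := constants_subfield subL.
have [S1 _ SM _] := subF.
have [D0 LD0 D0n0] := has_rank_nonzero rankL.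
have [Z [LZ Z0 LZ0]] := nilpotent_central subL nilL LD0 D0n0.
have dZ := subalgebra_derivation subL LZ.
have LFZ E : L E -> exists2 r, constants L r & E = r *: Z.
  move=> LE; have [r Er] := has_rank1_gen rankL LZ Z0 LE; exists r => //.
  have : bracket Z E = 0 by rewrite bracketC LZ0 ?oppr0.
  rewrite Er (bracket_scale _ _ dZ) bracketxx scaler0 addr0 => /eqP.
  rewrite scaler_eq0 (negPf Z0) orbF => /eqP Zr E' LE'.
  have [s ->] := has_rank1_gen rankL LZ Z0 LE'.
  by change (s * Z r = 0); rewrite Zr mulr0.
split=> [D E LD /LFZ[r Fr ->]|].
  rewrite (bracket_scale _ _ (subalgebra_derivation subL LD)).
  by rewrite Fr // LZ0 // scale0r scaler0 addr0.
exists (fun _ => Z); split=> [_|c _|]; first exact: lin_span_gen.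
  rewrite big_ord1 => /eqP; rewrite scaler_eq0 (negPf Z0) orbF => /eqP c0 i.
  by rewrite ord1.
rewrite eqEsubset; split; apply: lin_span_min.
- exact: lin_span0.
- by move=> *; apply: lin_spanD.
- by move=> *; apply: lin_spanZ.
- by move=> _ [i _ <-]; apply: lin_span_gen.
- exact: lin_span0.
- by move=> *; apply: lin_spanD.
- by move=> *; apply: lin_spanZ.
- by move=> E /LFZ[r Fr ->]; apply: lin_spanZ => //; apply: lin_span_gen => //; exists ord0.
Qed.

End Derivations.

Lemma prime_dvdn_fact p k : prime p -> (p %| k`!)%N -> (p <= k)%N.
Proof.
move=> pr_p; elim: k => [|k IH]; first by rewrite fact0 Euclid_dvd1.
rewrite factS Euclid_dvdM // => /orP[/dvdn_leq -> //|/IH]; exact: leqW.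
Qed.

Lemma fact_neq0_pchar (R : idomainType) k :
  (forall p, p \in [pchar R] -> (k < p)%N) -> k`!%:R != 0 :> R.
Proof.
move=> small; apply/negP => fk0.
have [p chp] := natf0_pchar (fact_gt0 k) fk0.
move: fk0; rewrite -(dvdn_pcharf chp) => /prime_dvdn_fact.
by rewrite (pcharf_prime chp) => /(_ isT); rewrite leqNgt small.
Qed.

Lemma pchar_fraction (K : fieldType) (A : idomainAlgType K) :
  [pchar {fraction A}] =i [pchar K].
Proof.
by move=> p; rewrite (fmorph_pchar (@tofrac A \o in_alg A : {rmorphism K -> {fraction A}})).
Qed.

Theorem proposition1 (K : fieldType) (A : idomainAlgType K)
    (L : set (frac_map A)) (hL : lie_subalgebra L) (hnil : nilpotent_lie L) :
  (has_rank L 1 ->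
     abelian_lie L /\ has_dim (constants L) (span_F L) 1)
  /\
  (has_rank L 2 ->
   (forall p, p \in [pchar K] ->
      exists2 m, (m <= p.+1)%N & has_dim (constants L) (span_F L) m) ->
   exists (k : nat) (D1 D2 : frac_map A),
     [/\ span_F L D1, span_F L D2, bracket D1 D2 = 0 &
       if k is 0%N then
         span_F L = lin_span (constants L) [set D1; D2]
       else
         exists a : {fraction A},
           [/\ D1 a = 0, D2 a = 1, (k`!%:R : {fraction A}) != 0 &
             span_F L =
               lin_span (constants L)
                 ([set (a ^+ i / i`!%:R) *: D1 | i in [set i | (i <= k)%N]]
                  `|` [set D2])]]).
Proof.
split=> [|rankL dimL]; first exact: rank1_abelian.
have [F1 _ _ _] := constants_subfield hL.
have [D0 LD0 D0n0] := has_rank_nonzero rankL.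
have [Z [LZ Z0 LZ0]] := nilpotent_central hL hnil LD0 D0n0.
have [D [LD free_DZ gen_DZ]] := has_rank2_basis rankL LZ Z0.
have [n Ln] := hnil.
have [k [u [Uu Dku UDk]]] := Zcoef_cyclic hL Ln LD LZ LZ0 free_DZ gen_DZ.
have fact_neq0 i : (i <= k)%N -> i`!%:R != 0 :> {fraction A}.
  move=> le_ik; apply: fact_neq0_pchar => p; rewrite pchar_fraction.
  move=> /dimL[m le_mp dimFL]; rewrite (leq_ltn_trans le_ik) // -ltnS.
  apply: leq_trans le_mp.
  exact: (string_dim hL Ln LD LZ LZ0 free_DZ gen_DZ Uu Dku UDk).
exists k, Z, D; split; try exact: lin_span_gen.
  by rewrite bracketC LZ0 ?oppr0.
case: k Dku UDk fact_neq0 => [|k] Dku UDk fact_neq0.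
  exact: (span_F_plane hL Ln LD LZ LZ0 free_DZ gen_DZ UDk).
have Ua : Zcoef L Z (iter k D u).
  elim: k {Dku UDk fact_neq0} => //= k IH.
  by have [] := Zcoef_der hL Ln LD LZ LZ0 free_DZ gen_DZ IH.
have [Za _ _] := Zcoef_der hL Ln LD LZ LZ0 free_DZ gen_DZ Ua.
exists (iter k D u); split=> //; first exact: fact_neq0.
exact: (span_F_divided_powers hL Ln LD LZ LZ0 free_DZ gen_DZ Uu Dku UDk).
Qed.
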